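(* Let $(T^*Q,\omega^B,H)$ be a magnetic Hamiltonian system, with magnetic symplectic form $\omega^B=\omega-\pi_Q^*B$ on $T^*Q$, where $\omega$ is the canonical symplectic form on $T^*Q$ and $B$ is a closed two-form on $Q$. Let $\gamma:Q\to T^*Q$ be a one-form on $Q$, let $\lambda=\gamma\cdot\pi_Q:T^*Q\to T^*Q$, and for any symplectic map $\varepsilon:T^*Q\to T^*Q$ with respect to $\omega^B$ put $X^\varepsilon=T\pi_Q\cdot X^B_H\cdot\varepsilon$, where $X^B_H$ is the magnetic Hamiltonian vector field of the system. Then $\varepsilon$ is a solution of the equation $$T\varepsilon\cdot X^B_{H\cdot\varepsilon}=T\lambda\cdot X^B_H\cdot\varepsilon$$ if and only if it is a solution of the equation $$T\gamma\cdot X^\varepsilon=X^B_H\cdot\varepsilon ,$$ where $X^B_{H\cdot\varepsilon}$ is the magnetic Hamiltonian vector field of the function $H\cdot\varepsilon:T^*Q\to\mathbb{R}$.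
   Context: $Q$ is an $n$-dimensional smooth manifold, $\pi_Q:T^*Q\to Q$ is the cotangent bundle projection with tangent map $T\pi_Q:TT^*Q\to TQ$, and $\omega$ is the canonical symplectic form on $T^*Q$ (locally $\sum_i \mathbf{d}q^i\wedge\mathbf{d}p_i$). For a closed two-form $B$ on $Q$, $\omega^B=\omega-\pi_Q^*B$ is called a magnetic symplectic form. A magnetic Hamiltonian system is a triple $(T^*Q,\omega^B,H)$ with $H:T^*Q\to\mathbb{R}$ a smooth function. For any smooth $f:T^*Q\to\mathbb{R}$ the magnetic Hamiltonian vector field $X^B_f$ is defined by $\mathbf{i}_{X^B_f}\omega^B=\mathbf{d}f$. A one-form $\gamma\in\Omega^1(Q)$ is regarded as the map (section) $\gamma:Q\to T^*Q$. The dot denotes composition of maps; $T\gamma,T\lambda,T\varepsilon$ are tangent maps. A map $\varepsilon:T^*Q\to T^*Q$ is symplectic with respect to $\omega^B$ if it is smooth and $\varepsilon^*\omega^B=\omega^B$. Both equations are equalities of maps $T^*Q\to TT^*Q$. *)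

(* Defs.v *)
From HB Require Import structures.
From mathcomp Require Import all_boot all_order all_algebra.
From mathcomp Require Import all_classical all_reals all_analysis.
Set Implicit Arguments.
Unset Strict Implicit.
Unset Printing Implicit Defensive.
Import Order.TTheory GRing.Theory Num.Theory.
Import numFieldNormedType.Exports.
Local Open Scope classical_set_scope.
Local Open Scope ring_scope.

(* C^k on an open set [U].  The successor step asks every directional
   derivative to be C^k; for finite-dimensional [E], the only case used, this
   is the usual requirement that the Frechet derivative be C^k. *)
Fixpoint Ck_on (R : realType) (E F : normedModType R) (k : nat)
    (U : set E) (f : E -> F) : Prop :=
  match k with
  | 0%N => forall x, U x -> {for x, continuous f}
  | k'.+1 => (forall x, U x -> differentiable f x) /\
             (forall v, Ck_on k' U (fun x => 'd f x v))
  end.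

Definition smooth_on (R : realType) (E F : normedModType R)
    (U : set E) (f : E -> F) : Prop := forall k, Ck_on k U f.

(* An atlas on a bare set.  Only the values of [chart i] on [dom i], and of
   [chart_inv i] on the image of [dom i], are meaningful.  The preferred chart
   [chart_at x] around each point carries no geometric content: it only serves
   to represent tangent vectors at [x] by elements of the model space. *)
Record atlas (R : realType) (E : normedModType R) := Atlas {
  point :> Type ;
  index : Type ;
  dom : index -> set point ;
  chart : index -> point -> E ;
  chart_inv : index -> E -> point ;
  chart_at : point -> index
}.

Section Manifold.
Context (R : realType) (E : normedModType R) (M : atlas E).

Definition chart_image (i : index M) : set E := chart i @` dom i.

(* The topology generated by the atlas. *)
Definition manifold_open (O : set M) : Prop :=
  forall i : index M, open (chart i @` (O `&` dom i)).

Record smooth_manifold : Prop := SmoothManifold {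
  chart_at_dom : forall x : M, dom (chart_at x) x ;
  chartK : forall (i : index M) x, dom i x -> chart_inv i (chart i x) = x ;
  overlap_open : forall i j : index M, open (chart i @` (dom i `&` dom j)) ;
  transition_smooth : forall i j : index M,
    smooth_on (chart i @` (dom i `&` dom j)) (chart j \o chart_inv i) ;
  manifold_hausdorff : forall x y : M, x <> y ->
    exists O1 O2, [/\ manifold_open O1, manifold_open O2, O1 x, O2 y &
                      O1 `&` O2 = set0] ;
  manifold_second_countable : exists b : nat -> set M,
    (forall k, manifold_open (b k)) /\
    (forall O x, manifold_open O -> O x -> exists k, b k x /\ b k `<=` O)
}.

(* The pair (x, v) is the tangent vector at [x] whose components in the chart
   [chart_at x] are [v]; thus T_x M is identified with [E]. *)
Definition tangent_bundle : Type := (M * E)%type.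

(* Change of components of a tangent vector at [x], from chart [i] to [j]. *)
Definition tangent_change (i j : index M) (x : M) (v : E) : E :=
  'd (chart j \o chart_inv i) (chart i x) v.

Definition smooth_function (f : M -> R) : Prop :=
  forall i : index M, smooth_on (chart_image i) (f \o chart_inv i : E -> R^o).

Definition differential (f : M -> R) (x : M) (v : E) : R :=
  'd (f \o chart_inv (chart_at x) : E -> R^o) (chart (chart_at x) x) v.

(* [W x v w] is the value of [W] at [x] on the tangent vectors (x, v), (x, w). *)
Definition two_form_field : Type := M -> E -> E -> R.

Definition two_form_local (W : two_form_field) (i : index M)
    (u v w : E) : R :=
  let x := chart_inv i u in
  W x (tangent_change i (chart_at x) x v) (tangent_change i (chart_at x) x w).

Record two_form (W : two_form_field) : Prop := TwoForm {
  two_form_linear : forall x (a : R) v v' w,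
    W x (a *: v + v') w = a * W x v w + W x v' w ;
  two_form_skew : forall x v w, W x v w = - W x w v ;
  two_form_smooth : forall (i : index M) v w,
    smooth_on (chart_image i) ((fun u => two_form_local W i u v w) : E -> R^o)
}.

Definition ext_deriv_local (W : two_form_field) (i : index M)
    (u v1 v2 v3 : E) : R :=
  let D a b c := 'd ((fun u' => two_form_local W i u' b c) : E -> R^o) u a in
  D v1 v2 v3 - D v2 v1 v3 + D v3 v1 v2.

Definition closed_two_form (W : two_form_field) : Prop :=
  two_form W /\
  forall (i : index M) u v1 v2 v3, chart_image i u ->
    ext_deriv_local W i u v1 v2 v3 = 0.

(* The vector field X with i_X W = df, pointwise; it is uniquely determined
   whenever [W] is nondegenerate. *)
Definition hamiltonian_field (W : two_form_field) (f : M -> R) (x : M) :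
    tangent_bundle :=
  (x, xget 0 [set v | forall w, W x v w = differential f x w]).

End Manifold.

Section Maps.
Context (R : realType) (E F : normedModType R) (M : atlas E) (N : atlas F).

(* The openness clause is the continuity of [f]. *)
Definition smooth_map (f : M -> N) : Prop :=
  forall (i : index M) (j : index N),
    let U := chart i @` (dom i `&` f @^-1` dom j) in
    open U /\ smooth_on U (chart j \o f \o chart_inv i).

Definition tangent_map_at (f : M -> N) (x : M) (v : E) : F :=
  'd (chart (chart_at (f x)) \o f \o chart_inv (chart_at x))
     (chart (chart_at x) x) v.

Definition tangent_map (f : M -> N) (v : tangent_bundle M) :
    tangent_bundle N :=
  (f v.1, tangent_map_at f v.1 v.2).

Definition pullback (f : M -> N) (W : two_form_field N) : two_form_field M :=
  fun x v w => W (f x) (tangent_map_at f x v) (tangent_map_at f x w).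

End Maps.

Section Cotangent.
Context (R : realType) (n : nat) (Q : atlas 'rV[R]_n).

Definition pairing (a v : 'rV[R]_n) : R := \sum_(k < n) a 0 k * v 0 k.

(* Change of components of a covector at [x], from chart [i] to [j]: the
   covector is precomposed with the change of tangent components from [j] to
   [i]. *)
Definition covector_change (i j : index Q) (x : Q) (a : 'rV[R]_n) :
    'rV[R]_n :=
  \row_k pairing a (tangent_change j i x (delta_mx 0 k)).

(* T^*Q.  The point (x, a) is the covector at [x] with components [a] in the
   chart [chart_at x], so the underlying set is a product although the bundle
   need not be trivial: the manifold structure is given by the bundle charts
   (q, p) induced by the charts q of [Q]. *)
Definition cotangent : atlas ('rV[R]_n * 'rV[R]_n)%type := {|
  point := (Q * 'rV[R]_n)%type ;
  index := index Q ;
  dom := fun i => [set z | dom i z.1] ;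
  chart := fun i z => (chart i z.1, covector_change (chart_at z.1) i z.1 z.2) ;
  chart_inv := fun i u =>
    let x := chart_inv i u.1 in (x, covector_change i (chart_at x) x u.2) ;
  chart_at := fun z => chart_at z.1
|}.

Definition cotangent_proj (z : cotangent) : Q := z.1.

Definition one_form (g : Q -> cotangent) : Prop :=
  (forall x, cotangent_proj (g x) = x) /\ smooth_map g.

(* sum_k dq^k /\ dp_k, computed at each point in the preferred bundle chart;
   the sum has the same value in every bundle chart around that point. *)
Definition canonical_form : two_form_field cotangent :=
  fun _ v w => \sum_(k < n) (v.1 0 k * w.2 0 k - w.1 0 k * v.2 0 k).

Definition magnetic_form (B : two_form_field Q) : two_form_field cotangent :=
  fun z v w => canonical_form z v w - pullback cotangent_proj B z v w.

Definition symplectic_map (W : two_form_field cotangent)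
    (f : cotangent -> cotangent) : Prop :=
  smooth_map f /\ pullback f W = W.

End Cotangent.

(* Main.v *)
Require Import Defs.
From mathcomp Require Import all_boot all_order all_algebra.
From mathcomp Require Import all_classical all_reals all_analysis.
From mathcomp Require Import ring.
Import numFieldNormedType.Exports.
Local Open Scope ring_scope.
Import Order.TTheory GRing.Theory Num.Theory.

(** Two facts turn both equations into the same one,
    X_H eps = T(gamma) T(pi) X_H eps.

    The first is that a symplectic map relates Hamiltonian fields:
    T(eps) X_(H eps) = X_H eps ([tangent_map_hamiltonian]).  Indeed, writing A
    for the tangent map of eps at z and W for the magnetic form, the identity
    W(A v, A w) = W(v, w) together with the nondegeneracy of
    W ([magnetic_form_inj]) makes A injective, hence
    surjective, since A is an endomorphism of the finite-dimensional model
    space.  If v is the value of X_(H eps) at z, then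
    W(A v, A w) = W(v, w) = d(H eps)(w) = dH(A w) for every w; as A is
    surjective, A v solves the equation that defines X_H at eps z, whose
    solution is unique.

    The second is the chain rule ([tangent_map_at_comp]), which gives
    T(lambda) = T(gamma) T(pi).  It needs from the two inner atlases only that
    charts and their inverses match ([charted]).  For the cotangent bundle this
    holds because the changes of components of covectors between two charts
    are mutually inverse ([cotangent_charted]); the rest of its manifold
    structure plays no role. *)

(** * Differentials of germs *)

Section Germs.
Context {R : numFieldType} {V W : normedModType R}.

(** The differential depends only on the germ of the function.  Representatives
    in charts compose only near the point, so the chain rule rests on this. *)
Lemma near_eq_diff {f g : V -> W} {x : V} :
  (\forall y \near x, f y = g y) -> differentiable g x ->
  differentiable f x /\ 'd f x = 'd g x :> (V -> W).
Proof.
move=> fg dg.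
have fgx : f x = g x by exact: nbhs_singleton fg.
have expansion : f \o shift x = cst (f x) + 'd g x +o_ 0 id.
  apply/eqaddoP => _/posnumP[e].
  have /diff_locallyP[_ /eqaddoP /(_ e%:num) /(_ [gt0 of e%:num])] := dg.
  rewrite /= !near_simpl; apply: filter_app.
  have : \forall h \near (0 : V), f (h + x) = g (h + x).
    by move: fg; rewrite (near_shift 0) /=; apply: filterS => h /=; rewrite subr0.
  by apply: filterS => h /= fgh; rewrite !fctE /= fgh fgx.
have dfg : 'd f x = 'd g x :> (V -> W).
  by apply: diff_unique => //; exact: diff_continuous.
split=> //; apply/diff_locallyP; rewrite dfg; split=> //.
exact: diff_continuous.
Qed.

End Germs.

(** * The chain rule in charts *)

(** The part of the definition of a smooth manifold that involves no topology:
    the preferred chart at a point contains it, and [chart_inv i] is a left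
    inverse of [chart i] on [dom i]. *)
Definition charted {R : realType} {E : normedModType R} (M : atlas E) : Prop :=
  (forall x : M, dom (chart_at x) x) /\
  (forall (i : Defs.index M) x, dom i x -> chart_inv i (chart i x) = x).

(** Differentiability of a map at a point, read in the preferred charts; the
    first clause, a consequence of continuity, makes the local representative
    meaningful near the point. *)
Definition differentiable_map_at {R : realType} {E F : normedModType R}
    {M : atlas E} {N : atlas F} (f : M -> N) (x : M) : Prop :=
  (\forall u \near chart (chart_at x) x,
     dom (chart_at (f x)) (f (chart_inv (chart_at x) u))) /\
  differentiable (chart (chart_at (f x)) \o f \o chart_inv (chart_at x))
    (chart (chart_at x) x).

Section ChainRule.
Context {R : realType} {E F G : normedModType R}.
Context {M : atlas E} {N : atlas F} {P : atlas G}.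
Hypotheses (hM : charted M) (hN : charted N).

Lemma smooth_map_differentiable (f : M -> N) (x : M) :
  smooth_map f -> differentiable_map_at f x.
Proof.
move: hM hN => [domM chM] [domN _] sf.
have [oU sU] := sf (chart_at x) (chart_at (f x)).
have Ux : (chart (chart_at x) @`
    (dom (chart_at x) `&` f @^-1` dom (chart_at (f x))))%classic
    (chart (chart_at x) x).
  by exists x => //; split; [exact: domM|exact: domN].
split; last by have [/(_ _ Ux)] := sU 1%N.
apply: filterS (open_nbhs_nbhs (conj oU Ux)) => _ [y [dy fy] <-].
by rewrite chM.
Qed.

Lemma tangent_map_at_comp (f : M -> N) (g : N -> P) (x : M) v :
  differentiable_map_at f x -> differentiable_map_at g (f x) ->
  tangent_map_at (g \o f) x v = tangent_map_at g (f x) (tangent_map_at f x v).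
Proof.
move: hM hN => [domM chM] [domN chN] [fdom df] [_ dg].
rewrite /tangent_map_at /=.
set i := chart_at x; set j := chart_at (f x); set k := chart_at (g (f x)).
have fx : (chart j \o f \o chart_inv i) (chart i x) = chart j (f x).
  by rewrite /= chM //; exact: domM.
have E1 : \forall u \near chart i x, (chart k \o (g \o f) \o chart_inv i) u =
    ((chart k \o g \o chart_inv j) \o (chart j \o f \o chart_inv i)) u.
  by apply: filterS fdom => u du /=; rewrite chN.
rewrite -fx in dg.
have [_ ->] := near_eq_diff E1 (differentiable_comp df dg).
by rewrite diff_comp //= chM //; exact: domM.
Qed.

Lemma differential_comp (f : M -> N) (h : N -> R) (x : M) v :
  differentiable_map_at f x -> smooth_function h ->
  differential (h \o f) x v = differential h (f x) (tangent_map_at f x v).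
Proof.
move: hM hN => [domM chM] [domN chN] [fdom df] sh.
rewrite /differential /tangent_map_at /=.
set i := chart_at x; set j := chart_at (f x).
have fx : (chart j \o f \o chart_inv i) (chart i x) = chart j (f x).
  by rewrite /= chM //; exact: domM.
have E1 : \forall u \near chart i x, ((h \o f) \o chart_inv i : E -> R^o) u =
    ((h \o chart_inv j : F -> R^o) \o (chart j \o f \o chart_inv i)) u.
  by apply: filterS fdom => u du /=; rewrite chN.
have dh : differentiable (h \o chart_inv j : F -> R^o) (chart j (f x)).
  by have [+ _] := sh j 1%N; apply; exists (f x) => //; exact: domN.
rewrite -fx in dh.
have [_ ->] := near_eq_diff E1 (differentiable_comp df dh).
by rewrite diff_comp //= chM //; exact: domM.
Qed.

End ChainRule.

(** * The atlas of the cotangent bundle *)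

Section CotangentAtlas.
Context {R : realType} {n : nat} {Q : atlas 'rV[R]_n}.
Hypothesis hQ : smooth_manifold Q.

Lemma smooth_manifold_charted : charted Q.
Proof. by case: hQ => h1 h2 _ _ _ _; split. Qed.

Lemma chart_image_near {i : Defs.index Q} {x : Q} : dom i x ->
  nbhs (chart i x) (chart_image i).
Proof.
move=> dx; apply: open_nbhs_nbhs; split; last by exists x.
by have := overlap_open hQ i i; rewrite setIid.
Qed.

Lemma tangent_changeK (i j : Defs.index Q) (x : Q) v : dom i x -> dom j x ->
  tangent_change j i x (tangent_change i j x v) = v.
Proof.
move=> di dj; rewrite /tangent_change.
have trans (k l : Defs.index Q) : dom k x -> dom l x ->
    differentiable (chart l \o chart_inv k) (chart k x).
  move=> dk dl; have [+ _] := transition_smooth hQ k l 1%N; apply.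
  by exists x.
have ij : (chart j \o chart_inv i) (chart i x) = chart j x.
  by rewrite /= (chartK hQ).
have Id : \forall u \near chart i x,
    ((chart i \o chart_inv j) \o (chart j \o chart_inv i)) u = id u.
  have U : nbhs (chart i x) (chart i @` (dom i `&` dom j))%classic.
    by apply: open_nbhs_nbhs; split; [exact: overlap_open hQ i j|exists x].
  by apply: filterS U => _ [y [yi yj] <-] /=; rewrite !(chartK hQ).
have dji : differentiable (chart i \o chart_inv j)
    ((chart j \o chart_inv i) (chart i x)) by rewrite ij; exact: trans.
have [] := is_diff_id (chart i x) => did dval.
have [_ Ed] := near_eq_diff Id did.
have := congr1 (@^~ v)
  (etrans (esym (diff_comp (trans i j di dj) dji)) (etrans Ed dval)).
by rewrite ij.
Qed.

Lemma pairing_delta (a : 'rV[R]_n) k : pairing a (delta_mx 0 k) = a 0 k.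
Proof.
rewrite /pairing (bigD1 k) //= mxE !eqxx mulr1 big1 ?addr0// => l lk.
by rewrite mxE (negbTE lk) andbF mulr0.
Qed.

(** The change of covector components from [i] to [j] is the transpose of the
    change of tangent components from [j] to [i]. *)
Lemma pairing_covector_change (i j : Defs.index Q) (x : Q) a v :
  pairing (covector_change i j x a) v = pairing a (tangent_change j i x v).
Proof.
rewrite {2}(row_sum_delta v) /tangent_change linear_sum /=.
rewrite /pairing.
under [RHS]eq_bigr => l _ do rewrite summxE big_distrr /=.
rewrite exchange_big /=; apply: eq_bigr => k _.
rewrite !mxE /pairing big_distrl /=; apply: eq_bigr => l _.
by rewrite linearZ /= mxE -mulrA (mulrC (v 0 k)).
Qed.

Lemma covector_changeK (i j : Defs.index Q) (x : Q) a : dom i x -> dom j x ->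
  covector_change j i x (covector_change i j x a) = a.
Proof.
move=> di dj; apply/rowP => k; rewrite mxE pairing_covector_change.
by rewrite tangent_changeK// pairing_delta.
Qed.

Lemma cotangent_charted : charted (cotangent Q).
Proof.
split=> [[x a]|i [x a] /= di]; first exact: (chart_at_dom hQ).
by rewrite (chartK hQ)// covector_changeK//; exact: (chart_at_dom hQ).
Qed.

Lemma cotangent_chart_image_near (z : cotangent Q) :
  \forall u \near chart (chart_at z) z, chart_image (chart_at z.1) u.1.
Proof.
have := chart_image_near (chart_at_dom hQ z.1).
exact: (@cvg_fst _ _ _ (nbhs (chart (chart_at z) z).2) _).
Qed.

(** In the preferred charts the bundle projection is the first projection of
    the model space. *)
Lemma cotangent_proj_near (z : cotangent Q) :
  \forall u \near chart (chart_at z) z,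
    (chart (chart_at (cotangent_proj z)) \o @cotangent_proj R n Q \o
      chart_inv (chart_at z)) u = fst u.
Proof.
apply: filterS (cotangent_chart_image_near z) => u [y dy yu].
by rewrite /= -yu (chartK hQ).
Qed.

Lemma fst_continuous :
  continuous (fst : 'rV[R]_n * 'rV[R]_n -> 'rV[R]_n).
Proof. by move=> u; exact: cvg_fst. Qed.

Lemma differentiable_cotangent_proj (z : cotangent Q) :
  differentiable_map_at (@cotangent_proj R n Q) z.
Proof.
split.
  apply: filterS (cotangent_chart_image_near z) => u [y dy yu].
  by rewrite /= -yu (chartK hQ).
have dfst := linear_differentiable (chart (chart_at z) z) fst_continuous.
by have [] := near_eq_diff (cotangent_proj_near z) dfst.
Qed.

Lemma tangent_map_cotangent_proj (z : cotangent Q) v :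
  tangent_map_at (@cotangent_proj R n Q) z v = v.1.
Proof.
have dfst := linear_differentiable (chart (chart_at z) z) fst_continuous.
have [_ dproj] := near_eq_diff (cotangent_proj_near z) dfst.
rewrite /tangent_map_at dproj diff_lin //; exact: fst_continuous.
Qed.

End CotangentAtlas.

(** * Nondegeneracy of the magnetic form *)

Section Magnetic.
Context {R : realType} {n : nat} {Q : atlas 'rV[R]_n}.
Hypothesis hQ : smooth_manifold Q.
Context {B : two_form_field Q}.
Hypothesis hB : two_form B.

Lemma linear_form_coord (f : 'rV[R]_n -> R) :
  (forall a u v, f (a *: u + v) = a * f u + f v) ->
  forall w, f w = \sum_(k < n) w 0 k * f (delta_mx 0 k).
Proof.
move=> fl w.
have f0 : f 0 = 0.
  by have := fl (-1) 0 0; rewrite scaler0 addr0 mulN1r addNr.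
rewrite {1}(row_sum_delta w).
elim/big_rec2: _ => [//|k y1 y2 _ <-]; exact: fl.
Qed.

Lemma two_form_linear_r x a v w w' :
  B x v (a *: w + w') = a * B x v w + B x v w'.
Proof.
by rewrite !(two_form_skew hB x v) (two_form_linear hB) opprD mulrN.
Qed.

Lemma two_form_r0 x v : B x v 0 = 0.
Proof.
by have := two_form_linear_r x (-1) v 0 0; rewrite scaler0 addr0 mulN1r addNr.
Qed.

(** The magnetic form with T(pi) computed: B sees only the base
    components. *)
Lemma magnetic_formE (z : cotangent Q) v w :
  magnetic_form B z v w =
  pairing v.1 w.2 - pairing v.2 w.1 - B z.1 v.1 w.1.
Proof.
rewrite /magnetic_form /pullback !(tangent_map_cotangent_proj hQ); congr (_ - _).
by rewrite -sumrB; apply: eq_bigr => k _; rewrite [_ * v.2 _ _]mulrC.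
Qed.

Lemma pairing_r0 (a : 'rV[R]_n) : pairing a 0 = 0.
Proof. by rewrite /pairing big1// => k _; rewrite mxE mulr0. Qed.

(** Testing against (0, e_k) recovers the base components; once these agree,
    the B terms agree too, and testing against (e_k, 0) recovers the fibre
    components. *)
Lemma magnetic_form_inj (z : cotangent Q) v v' :
  (forall w, magnetic_form B z v w = magnetic_form B z v' w) -> v = v'.
Proof.
case: v v' => [q p] [q' p'] vv'.
have qq' : q = q'.
  apply/rowP => k; have := vv' (0, delta_mx 0 k).
  by rewrite !magnetic_formE /= !two_form_r0 !pairing_r0 !pairing_delta !subr0.
congr pair => //; apply/rowP => k; have := vv' (delta_mx 0 k, 0).
rewrite !magnetic_formE /= !pairing_r0 !pairing_delta qq'.
by move=> /addIr /addrI /oppr_inj.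
Qed.

(** Nondegeneracy in the form of a Riesz representation: existence of
    Hamiltonian vectors. *)
Lemma magnetic_form_represent (z : cotangent Q)
    (L : 'rV[R]_n * 'rV[R]_n -> R) :
  (forall a u v, L (a *: u + v) = a * L u + L v) ->
  exists v, forall w, magnetic_form B z v w = L w.
Proof.
move=> Ll.
(* W((q, p), (0, e_k)) = q_k and W((q, p), (e_k, 0)) = - p_k - B(q, e_k). *)
pose q : 'rV[R]_n := \row_k L (0, delta_mx 0 k).
pose p : 'rV[R]_n := \row_k (- L (delta_mx 0 k, 0) - B z.1 q (delta_mx 0 k)).
exists (q, p) => -[w1 w2]; rewrite magnetic_formE /=.
have -> : L (w1, w2) = L (w1, 0) + L (0, w2).
  rewrite -[L (w1, 0)]mul1r -Ll scale1r; congr L.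
  by congr pair; rewrite /= ?addr0 ?add0r.
rewrite (@linear_form_coord (fun w => L (w, 0))); last first.
  move=> a u v; rewrite -Ll; congr L; congr pair => /=.
  by rewrite scaler0 addr0.
rewrite (@linear_form_coord (fun w => L (0, w))); last first.
  move=> a u v; rewrite -Ll; congr L; congr pair => /=.
  by rewrite scaler0 addr0.
rewrite (linear_form_coord (B z.1 q)); last by move=> *; exact: two_form_linear_r.
rewrite /pairing -!sumrB -big_split /=; apply: eq_bigr => k _.
rewrite !mxE; ring.
Qed.

Lemma differential_linear (f : cotangent Q -> R) (z : cotangent Q) a u v :
  differential f z (a *: u + v) = a * differential f z u + differential f z v.
Proof. by rewrite /differential linearP. Qed.

(** The default value in the definition of [hamiltonian_field] is never used
    for the magnetic form. *)
Lemma hamiltonian_fieldP (f : cotangent Q -> R) (z : cotangent Q) w :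
  magnetic_form B z (hamiltonian_field (magnetic_form B) f z).2 w =
  differential f z w.
Proof.
have [v vP] := magnetic_form_represent z _ (differential_linear f z).
rewrite /hamiltonian_field /=.
have /(xgetPex 0) : exists v, [set v | forall w,
  magnetic_form B z v w = differential f z w]%classic v by exists v.
exact.
Qed.

(** Preserving a nondegenerate form makes the tangent map injective, hence
    surjective by equality of dimensions. *)
Lemma symplectic_tangent_surj (eps : cotangent Q -> cotangent Q)
    (z : cotangent Q) w :
  pullback eps (magnetic_form B) = magnetic_form B ->
  exists v, w = tangent_map_at eps z v.
Proof.
move=> epsW; pose A := linfun (tangent_map_at eps z).
have AE v : A v = tangent_map_at eps z v by rewrite lfunE.
have /lker0_limgf Afull : lker A == 0%VS.
  apply/lker0P => v v' /=; rewrite !AE => vv'.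
  apply: (magnetic_form_inj z) => u.
  by rewrite -epsW /pullback vv'.
have := memvf w; rewrite -Afull => /memv_imgP[v _ ->].
by exists v; rewrite AE.
Qed.

(** Symplectic maps relate the Hamiltonian fields of [H \o eps] and [H]. *)
Lemma tangent_map_hamiltonian (H : cotangent Q -> R)
    (eps : cotangent Q -> cotangent Q) :
  smooth_function H -> symplectic_map (magnetic_form B) eps ->
  let X := hamiltonian_field (magnetic_form B) in
  tangent_map eps \o X (H \o eps) = X H \o eps.
Proof.
move=> hH [seps epsW] X; apply/funext => z.
rewrite [LHS]/= [RHS]/=.
congr pair.
apply: (magnetic_form_inj (eps z)) => w.
have [v ->] := symplectic_tangent_surj eps z w epsW.
have cQ := cotangent_charted hQ.
(* Both sides equal W (X_(H eps) z, v), the left one by the invariance of W. *)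
rewrite hamiltonian_fieldP -(differential_comp cQ cQ) //; last first.
  exact: smooth_map_differentiable.
rewrite -hamiltonian_fieldP.
exact: (congr1 (fun W => W z (X (H \o eps) z).2 v) epsW).
Qed.

End Magnetic.

(** * Equivalence of the two equations *)

Theorem theorem3p7 (R : realType) (n : nat) (Q : atlas 'rV[R]_n)
    (hQ : smooth_manifold Q)
    (B : two_form_field Q) (hB : closed_two_form B)
    (H : cotangent Q -> R) (hH : smooth_function H)
    (gamma : Q -> cotangent Q) (hgamma : one_form gamma)
    (eps : cotangent Q -> cotangent Q)
    (heps : symplectic_map (magnetic_form B) eps) :
  let X := hamiltonian_field (magnetic_form B) in
  let lambda := gamma \o @cotangent_proj R n Q in
  let X_eps := tangent_map (@cotangent_proj R n Q) \o X H \o eps in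
  tangent_map eps \o X (H \o eps) = tangent_map lambda \o X H \o eps <->
  tangent_map gamma \o X_eps = X H \o eps.
Proof.
move=> X lambda X_eps.
have cT := cotangent_charted hQ.
have cQ := smooth_manifold_charted hQ.
have TeX : tangent_map eps \o X (H \o eps) = X H \o eps :=
  tangent_map_hamiltonian hQ (proj1 hB) H eps hH heps.
have TlX : tangent_map lambda \o X H \o eps = tangent_map gamma \o X_eps.
  apply/funext => z.
  have := tangent_map_at_comp cT cQ (@cotangent_proj R n Q) gamma (eps z)
    (X H (eps z)).2 (differentiable_cotangent_proj hQ (eps z))
    (smooth_map_differentiable cQ cT gamma _ (proj2 hgamma)).
  exact: (congr1 (fun u => (gamma (cotangent_proj (eps z)), u))).
split=> E; first exact: (etrans (esym TlX) (etrans (esym E) TeX)).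
exact: (etrans TeX (etrans (esym E) (esym TlX))).
Qed.
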